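(* Let $G$ be an affine game, let $G^L\in G^{\mathcal L}$ be a Left option of $G$, and let $G^{LR}\neq\overline\infty$ be a Right option of $G^L$ such that $G\geqslant G^{LR}$. Then $G=\{(G^{\mathcal L}\setminus\{G^L\})\cup G^{LR\mathcal L}\mid G^{\mathcal R}\}$, where $G^{LR\mathcal L}$ is the set of Left options of $G^{LR}$.
   Context: Affine games are defined recursively. There are two games without options, denoted $\infty$ and $\overline{\infty}$ (terminating games). Every other affine game is a form $G=\{G^{\mathcal L}\mid G^{\mathcal R}\}$, where $G^{\mathcal L}$ (Left options) and $G^{\mathcal R}$ (Right options) are non-empty finite sets of previously constructed affine games. Let $\mathbb A$ be the set of all affine games. Disjunctive sum: $G+H$ is undefined if one of $G,H$ is the form $\infty$ and the other is $\overline\infty$; it is $\infty$ if one is $\infty$ and the other is not $\overline\infty$; it is $\overline\infty$ if one is $\overline\infty$ and the other is not $\infty$; otherwise $G+H=\{G^{\mathcal L}+H,\,G+H^{\mathcal L}\mid G^{\mathcal R}+H,\,G+H^{\mathcal R}\}$. Outcomes: $o^L(G)=\mathbf L$ if $G=\infty$ or some $G^L\in G^{\mathcal L}$ has $o^R(G^L)=\mathbf L$, and $o^L(G)=\mathbf R$ otherwise; $o^R(G)=\mathbf R$ if $G=\overline\infty$ or some $G^R\in G^{\mathcal R}$ has $o^L(G^R)=\mathbf R$, and $o^R(G)=\mathbf L$ otherwise. With $\mathbf L>\mathbf R$, $o(G)=(o^L(G),o^R(G))$ is ordered componentwise. Order and equality: $G\geqslant H$ iff $o(G+X)\geqslant o(H+X)$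 for all $X\in\mathbb A\setminus\{\infty,\overline\infty\}$; $G=H$ (equality of games) iff $o(G+X)=o(H+X)$ for all such $X$. *)

(* Defs.v *)
From HB Require Import structures.
From mathcomp Require Import all_boot all_order finmap.
Set Implicit Arguments.
Unset Strict Implicit.
Unset Printing Implicit Defensive.

Local Open Scope fset_scope.

(* The type [affine] is built so that Leibniz equality is identity of forms,
   with options forming genuine finite sets.  A [tree] stores lists of options;
   it is canonical when, hereditarily, these lists are nonempty and are the
   canonical enumerations of their underlying sets. *)

Inductive tree := TInf | TNinf | TNode of seq tree & seq tree.

Fixpoint tree_nest_ind (P : tree -> Prop) (Pi : P TInf) (Pn : P TNinf)
    (Pt : forall l r, foldr (fun x => and (P x)) True l ->
                      foldr (fun x => and (P x)) True r -> P (TNode l r))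
    (t : tree) : P t :=
  let fix all_ind s : foldr (fun x => and (P x)) True s :=
    if s is x :: s' then conj (tree_nest_ind Pi Pn Pt x) (all_ind s') else I in
  match t with
  | TInf => Pi
  | TNinf => Pn
  | TNode l r => Pt l r (all_ind l) (all_ind r)
  end.

Fixpoint tree_enc (t : tree) : GenTree.tree bool :=
  match t with
  | TInf => GenTree.Leaf true
  | TNinf => GenTree.Leaf false
  | TNode l r =>
      GenTree.Node 0 [:: GenTree.Node 0 (map tree_enc l);
                         GenTree.Node 0 (map tree_enc r)]
  end.

Fixpoint tree_dec (t : GenTree.tree bool) : tree :=
  match t with
  | GenTree.Leaf b => if b then TInf else TNinf
  | GenTree.Node _ [:: GenTree.Node _ l; GenTree.Node _ r] =>
      TNode (map tree_dec l) (map tree_dec r)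
  | _ => TInf
  end.

Lemma tree_encK : cancel tree_enc tree_dec.
Proof.
have aux s : foldr (fun x => and (tree_dec (tree_enc x) = x)) True s ->
    map tree_dec (map tree_enc s) = s.
  by elim: s => //= a s IH [-> /IH ->].
by elim/tree_nest_ind => //= l r Hl Hr; rewrite !aux.
Qed.

HB.instance Definition _ := Countable.copy tree (can_type tree_encK).

Definition canonical_options (s : seq tree) :=
  (s != [::]) && (enum_fset (seq_fset tt s) == s).

Fixpoint canonical (t : tree) : bool :=
  if t is TNode l r then
    [&& canonical_options l, canonical_options r, all canonical l
      & all canonical r]
  else true.

Record affine := Affine { tree_of :> tree; _ : canonical tree_of }.
HB.instance Definition _ := [isSub for tree_of].
HB.instance Definition _ := [Countable of affine by <:].

Definition pinf : affine := @Affine TInf isT.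
Definition ninf : affine := @Affine TNinf isT.

Definition terminating (G : affine) := (G == pinf) || (G == ninf).

Definition options (s : seq tree) : {fset affine} := seq_fset tt (pmap insub s).
Definition lopts (G : affine) := options (if val G is TNode l _ then l else [::]).
Definition ropts (G : affine) := options (if val G is TNode _ r then r else [::]).

(* The game {L | R}; there is no such game when L or R is empty, and the value
   is then irrelevant. *)
Definition form (L R : {fset affine}) : affine :=
  insubd pinf (TNode (enum_fset [fset val x | x in L])
                     (enum_fset [fset val x | x in R])).

Lemma canonical_enum (A : {fset affine}) : A != fset0 ->
  canonical_options (enum_fset [fset val x | x in A]) &&
  all canonical (enum_fset [fset val x | x in A]).
Proof.
move=> A0; set s := enum_fset _; apply/andP; split; last first.
  by apply/allP => t /imfsetP[x _ ->]; apply: valP.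
apply/andP; split.
  have /fset0Pn[x xA] := A0; apply/eqP => sE.
  have : val x \in s by apply: in_imfset.
  by rewrite sE.
by apply/eqP; congr enum_fset; apply/fsetP => t; rewrite seq_fsetE.
Qed.

Lemma val_form L R : L != fset0 -> R != fset0 ->
  val (form L R) = TNode (enum_fset [fset val x | x in L])
                         (enum_fset [fset val x | x in R]).
Proof.
move=> /canonical_enum/andP[L1 L2] /canonical_enum/andP[R1 R2].
by rewrite insubdK // unfold_in /=; apply/and4P; split.
Qed.

Lemma in_options (s : seq tree) (x : affine) : (x \in options s) = (val x \in s).
Proof. by rewrite seq_fsetE mem_pmap_sub. Qed.

Lemma options_enum (A : {fset affine}) :
  options (enum_fset [fset val x | x in A]) = A.
Proof.
apply/fsetP => x; rewrite in_options.
by apply/imfsetP/idP => [[y yA /val_inj ->]//|xA]; exists x.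
Qed.

Lemma lopts_form L R : L != fset0 -> R != fset0 -> lopts (form L R) = L.
Proof. by move=> L0 R0; rewrite /lopts val_form // options_enum. Qed.

Lemma ropts_form L R : L != fset0 -> R != fset0 -> ropts (form L R) = R.
Proof. by move=> L0 R0; rewrite /ropts val_form // options_enum. Qed.

Lemma form_terminating L R : L != fset0 -> R != fset0 ->
  ~~ terminating (form L R).
Proof. by move=> L0 R0; rewrite negb_or -!val_eqE val_form. Qed.

Lemma lopts_terminating G : terminating G -> lopts G = fset0.
Proof. by case/orP => /eqP ->; apply/fsetP => x; rewrite in_options. Qed.

Lemma ropts_terminating G : terminating G -> ropts G = fset0.
Proof. by case/orP => /eqP ->; apply/fsetP => x; rewrite in_options. Qed.

Lemma enum_options (s : seq tree) : canonical_options s -> all canonical s ->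
  enum_fset [fset val x | x in options s] = s /\ options s != fset0.
Proof.
move=> /andP[s0 /eqP sE] /allP sC.
have mem_s t : t \in s -> exists2 x : affine, x \in options s & t = val x.
  by move=> ts; exists (Affine (sC t ts)); rewrite ?in_options.
split; last first.
  case: s s0 mem_s {sE sC} => // t s _ /(_ t (mem_head _ _))[x xo _].
  by apply/fset0Pn; exists x.
rewrite -[RHS]sE; congr enum_fset; apply/fsetP => t; rewrite seq_fsetE.
by apply/imfsetP/idP => [[x xo ->]|/mem_s//]; rewrite -in_options.
Qed.

Lemma opts_neq0 G : ~~ terminating G -> lopts G != fset0 /\ ropts G != fset0.
Proof.
case: G => [[||l r] C] //= _; have /and4P[lC rC lC' rC'] := C.
by case: (enum_options lC lC'); case: (enum_options rC rC').
Qed.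

Lemma formK G : ~~ terminating G -> form (lopts G) (ropts G) = G.
Proof.
move=> Gt; have [L0 R0] := opts_neq0 Gt; apply: val_inj; rewrite val_form //.
move: Gt {L0 R0}; case: G => [[||l r] C] //= _.
have /and4P[lC rC lC' rC'] := C; rewrite /lopts /ropts /=.
by case: (enum_options lC lC') => -> _; case: (enum_options rC rC') => -> _.
Qed.

Fixpoint tree_rank (t : tree) : nat :=
  if t is TNode l r then
    (maxn (\max_(i <- map tree_rank l) i) (\max_(i <- map tree_rank r) i)).+1
  else 0.

Definition rank (G : affine) : nat := tree_rank (val G).

Lemma rank_opts G x : x \in lopts G `|` ropts G -> rank x < rank G.
Proof.
case: G => [[||l r] C]; rewrite in_fsetU !in_options //= => xG.
rewrite /rank /= ltnS leq_max.
by case/orP: xG => xG; apply/orP; [left | right];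
  apply: leq_bigmax_seq => //; apply: map_f.
Qed.

Lemma affine_ind (P : affine -> Prop) :
  (forall G, (forall x, x \in lopts G `|` ropts G -> P x) -> P G) ->
  forall G, P G.
Proof.
move=> H G; have [n] := ubnP (rank G); elim: n G => // n IH G Gn.
by apply: H => x /rank_opts xG; apply: IH; apply: leq_trans xG _.
Qed.

(* The recursions below are on a bound [n] on the rank; the unfolding lemmas
   [addE], [oLE] and [oRE] are the recursive definitions themselves. *)

(* pinf + ninf is undefined; the value pinf given to it here is irrelevant, as
   this sum does not arise when one of the two summands is not terminating. *)
Fixpoint add_rec (n : nat) (G H : affine) : affine :=
  if (G == pinf) || (H == pinf) then pinf
  else if (G == ninf) || (H == ninf) then ninf
  else if n is m.+1 then
    form ([fset add_rec m x H | x in lopts G] `|`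
          [fset add_rec m G y | y in lopts H])
         ([fset add_rec m x H | x in ropts G] `|`
          [fset add_rec m G y | y in ropts H])
  else pinf.

Definition add (G H : affine) : affine := add_rec (rank G + rank H).+1 G H.

Lemma add_rec_stable n m G H : rank G + rank H < n -> rank G + rank H < m ->
  add_rec n G H = add_rec m G H.
Proof.
elim: n m G H => [//|n IH] [//|m] G H Hn Hm /=.
case: ifP => // _; case: ifP => // _.
have E x y : rank x + rank y < rank G + rank H ->
    add_rec n x y = add_rec m x y.
  by move=> xy; apply: IH; apply: leq_trans xy _.
have EG (A : {fset affine}) : A `<=` lopts G `|` ropts G ->
    [fset add_rec n x H | x in A] = [fset add_rec m x H | x in A].
  move=> /fsubsetP AG; apply: eq_in_imfset => // x xA.
  by apply: E; rewrite ltn_add2r; apply: rank_opts; apply: AG.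
have EH (A : {fset affine}) : A `<=` lopts H `|` ropts H ->
    [fset add_rec n G y | y in A] = [fset add_rec m G y | y in A].
  move=> /fsubsetP AH; apply: eq_in_imfset => // x xA.
  by apply: E; rewrite ltn_add2l; apply: rank_opts; apply: AH.
by rewrite !EG ?EH ?fsubsetUl ?fsubsetUr.
Qed.

Lemma addE G H : add G H =
  if (G == pinf) || (H == pinf) then pinf
  else if (G == ninf) || (H == ninf) then ninf
  else form ([fset add x H | x in lopts G] `|` [fset add G y | y in lopts H])
            ([fset add x H | x in ropts G] `|` [fset add G y | y in ropts H]).
Proof.
rewrite {1}/add [LHS]/=; case: ifP => // _; case: ifP => // _.
have EG (A : {fset affine}) : A `<=` lopts G `|` ropts G ->
    [fset add_rec (rank G + rank H) x H | x in A] = [fset add x H | x in A].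
  move=> /fsubsetP AG; apply: eq_in_imfset => // x xA.
  by apply: add_rec_stable => //; rewrite ltn_add2r rank_opts // AG.
have EH (A : {fset affine}) : A `<=` lopts H `|` ropts H ->
    [fset add_rec (rank G + rank H) G y | y in A] = [fset add G y | y in A].
  move=> /fsubsetP AH; apply: eq_in_imfset => // x xA.
  by apply: add_rec_stable => //; rewrite ltn_add2l rank_opts // AH.
by rewrite !EG ?EH ?fsubsetUl ?fsubsetUr.
Qed.

(* Outcomes: [true] stands for L and [false] for R, so that L > R in bool. *)
Fixpoint outcome_rec (n : nat) (G : affine) : bool * bool :=
  if n is m.+1 then
    ((G == pinf) || has (fun x => (outcome_rec m x).2) (lopts G),
     ~~ ((G == ninf) || has (fun x => ~~ (outcome_rec m x).1) (ropts G)))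
  else (true, true).

Definition oL (G : affine) : bool := (outcome_rec (rank G).+1 G).1.
Definition oR (G : affine) : bool := (outcome_rec (rank G).+1 G).2.

Lemma outcome_rec_stable n m G : rank G < n -> rank G < m ->
  outcome_rec n G = outcome_rec m G.
Proof.
elim: n m G => [//|n IH] [//|m] G Gn Gm /=.
have E x : x \in lopts G `|` ropts G -> outcome_rec n x = outcome_rec m x.
  by move=> /rank_opts xG; apply: IH; apply: leq_trans xG _.
by congr (_ || _, ~~ (_ || _)); apply: eq_in_has => x xG;
  rewrite E // in_fsetU xG ?orbT.
Qed.

Lemma oLE G : oL G = (G == pinf) || has oR (lopts G).
Proof.
rewrite /oL /=; congr (_ || _); apply: eq_in_has => x xG; congr snd.
by apply: outcome_rec_stable => //; apply: rank_opts; rewrite in_fsetU xG.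
Qed.

Lemma oRE G : oR G = ~~ ((G == ninf) || has (fun x => ~~ oL x) (ropts G)).
Proof.
rewrite /oR /=; congr (~~ (_ || _)); apply: eq_in_has => x xG.
congr (~~ (fst _)); apply: outcome_rec_stable => //.
by apply: rank_opts; rewrite in_fsetU xG orbT.
Qed.

(* [*p] carries the componentwise order. *)
Definition outcome (G : affine) : (bool *p bool)%type := (oL G, oR G).

Definition game_ge (G H : affine) : Prop :=
  forall X, ~~ terminating X ->
    (outcome (add H X) <= outcome (add G X))%O.

Definition game_eq (G H : affine) : Prop :=
  forall X, ~~ terminating X -> outcome (add G X) = outcome (add H X).

(* Main.v *)
(* A winning Left move from [G + X] to [GL + X] is answered by Right's reversal
   to [GLR + X], from which Left again has a winning move: it is either a move
   to a Left option of [GLR], available in the new form, or a move in [X], which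
   still wins from [G] since [G >= GLR]; then induct on [X].  Conversely, a
   winning move to a Left option of [GLR] shows that Left moving first wins
   [GLR + X], hence [G + X]. *)
Require Import Defs.
From mathcomp Require Import all_boot all_order finmap.

Local Open Scope fset_scope.

Lemma lopt_nonterminating G x : x \in lopts G -> ~~ terminating G.
Proof. by move=> xG; apply/negP => /lopts_terminating E; rewrite E in xG. Qed.

Lemma ropt_nonterminating G x : x \in ropts G -> ~~ terminating G.
Proof. by move=> xG; apply/negP => /ropts_terminating E; rewrite E in xG. Qed.

Lemma add_pinfr G : add G pinf = pinf.
Proof. by rewrite addE eqxx orbT. Qed.

Lemma add_pinfl G : add pinf G = pinf.
Proof. by rewrite addE eqxx. Qed.

(** The case [G = pinf] has to be excluded: there [add] returns the default value [pinf]. *)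
Lemma add_ninfr G : ~~ terminating G -> add G ninf = ninf.
Proof. by case/norP => /negPf Gp /negPf Gn; rewrite addE Gp Gn. Qed.

Lemma add_form G H : ~~ terminating G -> ~~ terminating H ->
  add G H =
  form ([fset add x H | x in lopts G] `|` [fset add G y | y in lopts H])
       ([fset add x H | x in ropts G] `|` [fset add G y | y in ropts H]).
Proof.
move=> /norP[/negPf Gp /negPf Gn] /norP[/negPf Hp /negPf Hn].
by rewrite addE Gp Gn Hp Hn.
Qed.

Lemma imfsetU_neq0 (K : choiceType) (A B : {fset affine}) (f g : affine -> K) :
  A != fset0 -> [fset f x | x in A] `|` [fset g y | y in B] != fset0.
Proof.
by case/fset0Pn => x xA; apply/fset0Pn; exists (f x); rewrite in_fsetU in_imfset.
Qed.

Lemma add_nonterminating G H :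
  ~~ terminating G -> ~~ terminating H -> ~~ terminating (add G H).
Proof.
move=> Gt Ht; have [L0 R0] := opts_neq0 Gt.
by rewrite add_form //; apply: form_terminating; apply: imfsetU_neq0.
Qed.

Lemma lopts_add G H : ~~ terminating G -> ~~ terminating H ->
  lopts (add G H) =
  [fset add x H | x in lopts G] `|` [fset add G y | y in lopts H].
Proof.
move=> Gt Ht; have [L0 R0] := opts_neq0 Gt.
by rewrite add_form // lopts_form //; apply: imfsetU_neq0.
Qed.

Lemma ropts_add G H : ~~ terminating G -> ~~ terminating H ->
  ropts (add G H) =
  [fset add x H | x in ropts G] `|` [fset add G y | y in ropts H].
Proof.
move=> Gt Ht; have [L0 R0] := opts_neq0 Gt.
by rewrite add_form // ropts_form //; apply: imfsetU_neq0.
Qed.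

(** A sum of nonterminating games is itself nonterminating, so its outcome is decided only by moves
    in one of the summands. *)
Lemma oL_addP G H : ~~ terminating G -> ~~ terminating H ->
  reflect ((exists2 x, x \in lopts G & oR (add x H)) \/
           (exists2 y, y \in lopts H & oR (add G y)))
          (oL (add G H)).
Proof.
move=> Gt Ht; have /norP[/negPf np _] := add_nonterminating _ _ Gt Ht.
rewrite oLE np lopts_add //=; apply: (iffP hasP) => [[z]|].
  rewrite in_fsetU => /orP[] /imfsetP[x /= xA ->] xL; [left|right]; by exists x.
case=> [[x xA xL]|[y yA yL]].
  by exists (add x H); rewrite // in_fsetU (in_imfset _ (add^~ H)).
by exists (add G y); rewrite // in_fsetU (in_imfset _ (add G)) ?orbT.
Qed.

Lemma oR_addP G H : ~~ terminating G -> ~~ terminating H ->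
  reflect ((forall x, x \in ropts G -> oL (add x H)) /\
           (forall y, y \in ropts H -> oL (add G y)))
          (oR (add G H)).
Proof.
move=> Gt Ht; have /norP[_ /negPf nn] := add_nonterminating _ _ Gt Ht.
rewrite oRE nn ropts_add //= -all_predC; apply: (iffP allP) => [h|[hG hH] z].
  split=> x xA; apply/negPn/h; rewrite in_fsetU.
    by rewrite (in_imfset _ (add^~ H)).
  by rewrite (in_imfset _ (add G)) ?orbT.
by rewrite in_fsetU => /orP[] /imfsetP[x /= xA ->];
  rewrite negbK; [apply: hG | apply: hH].
Qed.

Lemma oR_ninf : oR ninf = false. Proof. by rewrite oRE eqxx. Qed.

Lemma oR_pinf : oR pinf.
Proof. by rewrite oRE ropts_terminating. Qed.

Lemma oL_ninf : oL ninf = false.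
Proof. by rewrite oLE lopts_terminating. Qed.

Lemma game_ge_outcome G H X : game_ge G H -> ~~ terminating X ->
  (oL (add H X) -> oL (add G X)) /\ (oR (add H X) -> oR (add G X)).
Proof.
(* As [true] encodes a win for Left, the order on outcomes is implication. *)
have le_implies (b c : bool) : (b <= c)%O -> b -> c by case: b c => [] [].
by move=> h /h /andP[/= /le_implies ? /le_implies ?].
Qed.

(* Right wins [G + {ninf | ninf}] by moving to [G + ninf = ninf]. *)
Lemma game_ge_pinf G : ~~ terminating G -> ~ game_ge G pinf.
Proof.
move=> Gt ge.
have n0 : [fset ninf] != fset0 by apply/fset0Pn; exists ninf; rewrite in_fset1.
have Xt := form_terminating n0 n0.
have [_] := game_ge_outcome _ _ _ ge Xt.
rewrite add_pinfl oR_pinf => /(_ isT)/(oR_addP _ _ Gt Xt).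
case=> _ /(_ ninf); rewrite ropts_form // in_fset1 eqxx => /(_ isT).
by rewrite add_ninfr // oL_ninf.
Qed.

Section Reversal.
Variables (G GL GLR : affine).
Hypotheses (hGL : GL \in lopts G) (hGLR : GLR \in ropts GL).
Hypotheses (GLRt : ~~ terminating GLR) (hge : game_ge G GLR).

Let L' := (lopts G `\ GL) `|` lopts GLR.
Let G' := form L' (ropts G).

Let Gt : ~~ terminating G. Proof. exact: lopt_nonterminating hGL. Qed.
Let GLt : ~~ terminating GL. Proof. exact: ropt_nonterminating hGLR. Qed.

(** Even if [GL] is the only Left option of [G], the nonterminating [GLR] supplies Left options. *)
Lemma reversal_lopts_neq0 : L' != fset0.
Proof.
have [/fset0Pn[x xL] _] := opts_neq0 GLRt.
by apply/fset0Pn; exists x; rewrite in_fsetU xL orbT.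
Qed.

Let R0 : ropts G != fset0. Proof. by have [] := opts_neq0 Gt. Qed.
Let G't : ~~ terminating G'.
Proof. exact: form_terminating reversal_lopts_neq0 R0. Qed.
Let lG' : lopts G' = L'. Proof. exact: lopts_form reversal_lopts_neq0 R0. Qed.
Let rG' : ropts G' = ropts G.
Proof. exact: ropts_form reversal_lopts_neq0 R0. Qed.

Lemma reversal_eq X : ~~ terminating X ->
  oL (add G X) = oL (add G' X) /\ oR (add G X) = oR (add G' X).
Proof.
elim/affine_ind: X => X IH Xt.
(* Options of [X] may be terminating, out of reach of the induction hypothesis; such a [Y] absorbs
   both sums alike. *)
have IHX Y : Y \in lopts X `|` ropts X ->
    oL (add G Y) = oL (add G' Y) /\ oR (add G Y) = oR (add G' Y).
  move=> YX; have [/orP[]/eqP->|Yt] := boolP (terminating Y).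
  - by rewrite !add_pinfr.
  - by rewrite !add_ninfr.
  - exact: IH.
have IHL Y : Y \in lopts X -> oR (add G Y) = oR (add G' Y).
  by move=> YX; have [] := IHX Y; rewrite // in_fsetU YX.
have IHR Y : Y \in ropts X -> oL (add G Y) = oL (add G' Y).
  by move=> YX; have [] := IHX Y; rewrite // in_fsetU YX orbT.
have geX Y := game_ge_outcome _ _ Y hge.
(* With Right to move, [G] and [G'] offer the same Right options, so only moves in [X] need
   induction. *)
split; last first.
  apply/(oR_addP _ _ Gt Xt)/(oR_addP _ _ G't Xt); rewrite rG' => -[hG hX];
    by split=> // Y YX; have := hX Y YX; rewrite IHR.
apply/(oL_addP _ _ Gt Xt)/(oL_addP _ _ G't Xt); rewrite lG'.
- case=> [[x xG xw]|[y yX yw]]; last by right; exists y; rewrite -?IHL.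
  have [xE|xGL] := eqVneq x GL; last first.
    by left; exists x; rewrite // !inE xGL xG.
  (* Left's win after moving to [GL] survives every reply of Right, in particular the one to
     [GLR]. *)
  move: xw; rewrite xE => /(oR_addP _ _ GLt Xt)[/(_ _ hGLR) + _].
  case/(oL_addP _ _ GLRt Xt) => [[z zL zw]|[y yX yw]].
    by left; exists z; rewrite // in_fsetU zL orbT.
  right; exists y => //; rewrite -IHL //.
  (* [game_ge] only tests nonterminating games. If [y] is [pinf], Left has won at once; [ninf] would
     contradict the win in [GLR + y]. *)
  have [/orP[]/eqP yE|yt] := boolP (terminating y).
  + by rewrite yE add_pinfr oR_pinf.
  + by move: yw; rewrite yE add_ninfr // oR_ninf.
  + by have [_] := geX y yt; apply.
- case=> [[x]|[y yX yw]]; last by right; exists y; rewrite ?IHL.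
  rewrite in_fsetU => /orP[|xL xw].
    by rewrite !inE => /andP[_ xG] xw; left; exists x.
  apply/(oL_addP _ _ Gt Xt); have [+ _] := geX X Xt; apply.
  by apply/(oL_addP _ _ GLRt Xt); left; exists x.
Qed.

End Reversal.

(** The first conjunct ensures that the new [form] is a genuine game and not the default value of
    [form] on empty sets. *)
Theorem theorem39 (G GL GLR : affine)
    (hGL : GL \in lopts G) (hGLR : GLR \in ropts GL) (hninf : GLR <> ninf)
    (hge : game_ge G GLR) :
  (lopts G `\ GL) `|` lopts GLR <> fset0 /\
  game_eq G (form ((lopts G `\ GL) `|` lopts GLR) (ropts G)).
Proof.
have GLRt : ~~ terminating GLR.
  (* [GLR = pinf] is ruled out by the order: [G] has the option [GL], so it is nonterminating and
     cannot dominate [pinf]. *)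
  apply/norP; split; apply/eqP => // E; rewrite E in hge.
  exact: game_ge_pinf (lopt_nonterminating _ _ hGL) hge.
split; first exact/eqP/reversal_lopts_neq0.
by move=> X Xt; have [eL eR] := reversal_eq _ _ _ hGL hGLR GLRt hge X Xt;
  rewrite /outcome eL eR.
Qed.
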